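(* Let $\alpha\mathbb{N}=\mathbb{N}\cup\{\infty\}$ be the one-point compactification of the discrete space $\mathbb{N}=\{0,1,2,\dots\}$, and define $D,R,S\subseteq\alpha\mathbb{N}\times\alpha\mathbb{N}$ by $$D=\{(x,x)\mid x\in\alpha\mathbb{N}\},$$ $$R=\{(2n,2n)\mid n\in\mathbb{N}\}\cup\{(2n+1,2n+3)\mid n\in\mathbb{N}\}\cup\{(\infty,\infty)\},$$ $$S=\{(2n,2n+2)\mid n\in\mathbb{N}\}\cup\{(2n+1,2n+1)\mid n\in\mathbb{N}\}\cup\{(\infty,\infty)\}.$$ (These are continuous relations on $\alpha\mathbb{N}$.) Then: (1) $D$ and $R$ do not have a meet in $\mathcal{CR}(\alpha\mathbb{N})$; (2) $D$ and $S$ do not have a meet in $\mathcal{CR}(\alpha\mathbb{N})$; (3) there do not exist continuous relations $R'\subseteq R$ and $S'\subseteq S$ on $\alpha\mathbb{N}$ such that $R'\cup S'=D$. Thus, the bounded join-semilattice $\mathcal{CR}(\alpha\mathbb{N})$ is neither distributive nor a lattice.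
   Context: A binary relation $R$ on a Stone space (compact Hausdorff zero-dimensional space) $X$ is continuous if $R[x]=\{y : x\mathrel{R}y\}$ is closed for each $x\in X$ and $R^{-1}[U]=\{x : x \mathrel{R} y \text{ for some } y\in U\}$ is clopen for each clopen $U\subseteq X$. $\mathcal{CR}(X)$ is the set of continuous relations on $X$, ordered by inclusion; it is a bounded join-semilattice in which binary joins are unions. A join-semilattice $L$ is distributive if for all $a,b,c\in L$, $a\le b\vee c$ implies that there are $b'\le b$ and $c'\le c$ with $a=b'\vee c'$. *)

(* Defs.v *)
From HB Require Import structures.
From mathcomp Require Import all_boot all_order.
From mathcomp Require Import zify.
From mathcomp Require Import all_classical topology.

Set Implicit Arguments.
Unset Strict Implicit.
Unset Printing Implicit Defensive.

Import Order.TTheory.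

Local Open Scope classical_set_scope.

Section ContinuousRelation.
Context {X : topologicalType}.
Implicit Types (R : set (X * X)) (U : set X).

Definition rel_image R (x : X) : set X := [set y | R (x, y)].

Definition rel_preimage R U : set X := [set x | exists2 y, U y & R (x, y)].

Definition continuous_relation R : Prop :=
  (forall x, closed (rel_image R x)) /\
  (forall U, clopen U -> clopen (rel_preimage R U)).

Lemma continuous_relation0 : continuous_relation set0.
Proof.
split=> [x|U _]; first exact: closed0.
suff -> : rel_preimage set0 U = set0 by exact: clopen0.
by rewrite -subset0 => x [].
Qed.

Lemma continuous_relationT : continuous_relation setT.
Proof.
split=> [x|U _]; first exact: closedT.
have [->|/set0P[y Uy]] := eqVneq U set0.
  suff -> : rel_preimage setT set0 = set0 by exact: clopen0.
  by rewrite -subset0 => x [].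
suff -> : rel_preimage setT U = setT by exact: clopenT.
by rewrite -subTset => x _; exists y.
Qed.

Lemma continuous_relationU R1 R2 : continuous_relation R1 ->
  continuous_relation R2 -> continuous_relation (R1 `|` R2).
Proof.
move=> [c1 p1] [c2 p2]; split=> [x|U cU]; first exact: closedU (c1 x) (c2 x).
suff -> : rel_preimage (R1 `|` R2) U = rel_preimage R1 U `|` rel_preimage R2 U.
  by apply: clopenU; [exact: p1|exact: p2].
apply/seteqP; split=> x.
  by move=> [y Uy [Rxy|Rxy]]; [left|right]; exists y.
by move=> [] [y Uy Rxy]; exists y => //; [left|right].
Qed.

Lemma continuous_relation_graph (f : X -> X) : hausdorff_space X ->
  continuous f -> continuous_relation [set (x, f x) | x in [set: X]].
Proof.
move=> hX cf; split=> [x|U cU].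
  suff -> : rel_image [set (x, f x) | x in [set: X]] x = [set f x].
    exact/accessible_closed_set1/hausdorff_accessible.
  by apply/seteqP; split=> y => [[z _ [-> ->]]//|->]; exists x.
suff -> : rel_preimage [set (x, f x) | x in [set: X]] U = f @^-1` U.
  exact: preimage_clopen.
apply/seteqP; split=> x => [[y Uy [z _ [<- fy]]]|Ufx]; first by rewrite /= fy.
by exists (f x) => //; exists x.
Qed.

End ContinuousRelation.

Record CR (X : topologicalType) := MkCR {
  CR_rel :> set (X * X);
  CR_relP : `[< continuous_relation CR_rel >]
}.

Section CROrder.
Context {X : topologicalType}.

HB.instance Definition _ := [isSub for @CR_rel X].
HB.instance Definition _ := [Choice of CR X by <:].
HB.instance Definition _ :=
  [SubChoice_isSubPOrder of CR X by <: with set_display].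

Definition toCR (R : set (X * X)) (cR : continuous_relation R) : CR X :=
  MkCR (asboolT cR).

Lemma CR_continuous (R : CR X) : continuous_relation R.
Proof. exact/asboolP/CR_relP. Qed.

Lemma CR_leE (R1 R2 : CR X) :
  (R1 <= R2)%O = ((R1 : set (X * X)) `<=` R2) :> Prop.
Proof. by rewrite -subsetEset. Qed.

Definition CR_join (R1 R2 : CR X) : CR X :=
  toCR (continuous_relationU (CR_continuous R1) (CR_continuous R2)).

Lemma CR_leUx (R1 R2 R : CR X) :
  (CR_join R1 R2 <= R)%O = (R1 <= R)%O && (R2 <= R)%O.
Proof.
apply/idP/andP => [|[]]; rewrite !CR_leE; first by rewrite /= subUset.
by move=> R1R R2R; rewrite /= subUset.
Qed.

HB.instance Definition _ :=
  Order.POrder_isJoinSemilattice.Build set_display (CR X) CR_leUx.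

Lemma CR_le0x (R : CR X) : (toCR continuous_relation0 <= R)%O.
Proof. by rewrite CR_leE; exact: sub0set. Qed.

Lemma CR_lex1 (R : CR X) : (R <= toCR continuous_relationT)%O.
Proof. by rewrite CR_leE; exact: subsetT. Qed.

HB.instance Definition _ :=
  Order.hasBottom.Build set_display (CR X) CR_le0x.

HB.instance Definition _ :=
  Order.hasTop.Build set_display (CR X) CR_lex1.

Lemma CR_joinE (R1 R2 : CR X) :
  Order.join R1 R2 = (R1 : set (X * X)) `|` R2 :> set (X * X).
Proof. by []. Qed.

End CROrder.

Definition distributive_joinSemilattice (d : Order.disp_t)
    (L : joinSemilatticeType d) : Prop :=
  forall a b c : L, (a <= Order.join b c)%O ->
  exists b' c' : L, [/\ (b' <= b)%O, (c' <= c)%O & a = Order.join b' c'].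

Definition has_meet (d : Order.disp_t) (L : porderType d) (a b : L) : Prop :=
  infimums [set a; b] !=set0.

Definition has_join (d : Order.disp_t) (L : porderType d) (a b : L) : Prop :=
  supremums [set a; b] !=set0.

Definition is_lattice (d : Order.disp_t) (L : porderType d) : Prop :=
  forall a b : L, has_meet a b /\ has_join a b.

(* The library topology on [nat] is the discrete one; [None] is the point at
   infinity. *)
Notation alphaN := (one_point_compactification nat).

Definition fin (n : nat) : alphaN := Some n.
Definition infty : alphaN := None.

Definition relD : set (alphaN * alphaN) := [set (x, x) | x in [set: alphaN]].

Definition relR : set (alphaN * alphaN) :=
  [set (fin (2 * n), fin (2 * n)) | n in [set: nat]] `|`
  [set (fin (2 * n + 1), fin (2 * n + 3)) | n in [set: nat]] `|`
  [set (infty, infty)].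

Definition relS : set (alphaN * alphaN) :=
  [set (fin (2 * n), fin (2 * n + 2)) | n in [set: nat]] `|`
  [set (fin (2 * n + 1), fin (2 * n + 1)) | n in [set: nat]] `|`
  [set (infty, infty)].

Lemma clopen_fin (n : nat) : clopen [set fin n].
Proof.
split.
  suff -> : [set fin n] = Some @` [set n].
    exact/one_point_compactification_open_some/discrete_open.
  by rewrite image_set1.
rewrite -openC openE => -[m mn|_].
  by apply: (@filterS _ (nbhs m) _ [set m]); [move=> k ->|exact: discrete_set1].
exists [set n]; first by split; [exact: compact_set1|exact: discrete_closed].
by move=> x [[k kn <-]|->]// [].
Qed.

Lemma alphaN_zero_dimensional : zero_dimensional alphaN.
Proof.
move=> [n|] [m|]//= nm.
- exists [set fin n]; split=> //; first exact: clopen_fin.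
  by move=> /= mn; rewrite mn eqxx in nm.
- by exists [set fin n]; split=> //; exact: clopen_fin.
- exists (~` [set fin m]); split=> //; last by apply.
  exact: (clopenC set0 (clopen_fin m)).
Qed.

Lemma alphaN_hausdorff : hausdorff_space alphaN.
Proof.
rewrite open_hausdorff => x y /alphaN_zero_dimensional[U [[oU cU] Ux Uy]].
exists (U, ~` U) => /=; first by rewrite !inE.
by split=> //; [exact: closed_openC|rewrite setICr].
Qed.

Lemma alphaN_stone :
  [/\ compact [set: alphaN], hausdorff_space alphaN & zero_dimensional alphaN].
Proof.
split; [exact: one_point_compactification_compact|exact: alphaN_hausdorff|].
exact: alphaN_zero_dimensional.
Qed.

Lemma alphaN_continuous (f : nat -> nat) : (forall n, (n <= f n)%N) ->
  continuous (omap f : alphaN -> alphaN).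
Proof.
move=> lef [n|] A.
  move=> /nbhs_singleton Afn.
  by apply: (@filterS _ (nbhs n) _ [set n]); [move=> k ->|exact: discrete_set1].
move=> [C [cC _] CA]; have [N CN] : exists N, forall k, C k -> (k < N)%N.
  have [D _ CD] : finite_subset_cover setT (fun n => [set n]) C.
    move: cC; rewrite compact_cover; apply.
      by move=> ? _; exact: discrete_open.
    by move=> k _; exists k.
  exists (\max_(i <- finmap.enum_fset D) i).+1 => k /CD[i /= iD ->].
  by rewrite ltnS; apply: leq_bigmax_seq.
exists `I_N.
  by split; [exact/finite_compact/finite_II|exact: discrete_closed].
move=> _ [[k kN <-]|->]; apply: CA; [left|by right].
by exists (f k) => // /CN fkN; apply: kN; exact: leq_ltn_trans (lef k) fkN.
Qed.

Lemma continuous_relD : continuous_relation relD.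
Proof.
apply: (continuous_relation_graph (f := id)); first exact: alphaN_hausdorff.
by move=> x A.
Qed.

Lemma continuous_relR : continuous_relation relR.
Proof.
pose f n := if odd n then n.+2 else n.
suff -> : relR = [set (x, omap f x : alphaN) | x in [set: alphaN]].
  apply: continuous_relation_graph; first exact: alphaN_hausdorff.
  by apply: alphaN_continuous => n; rewrite /f; case: ifP => // _; lia.
apply/seteqP; split=> [_ [[[n _ <-]|[n _ <-]]|->]|_ [[n|] _ <-]].
- exists (fin (2 * n)) => //=; rewrite /f; case: ifP => //; lia.
- exists (fin (2 * n + 1)) => //=; rewrite /f.
  by case: ifP => [_|]; [rewrite !addnS|lia].
- by exists infty.
- left; rewrite /= /f; case: ifP => on; [right|left]; exists n./2 => //.
    by congr (fin _, fin _); lia.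
  by congr (fin _, fin _); lia.
- by right.
Qed.

Lemma continuous_relS : continuous_relation relS.
Proof.
pose f n := if odd n then n else n.+2.
suff -> : relS = [set (x, omap f x : alphaN) | x in [set: alphaN]].
  apply: continuous_relation_graph; first exact: alphaN_hausdorff.
  by apply: alphaN_continuous => n; rewrite /f; case: ifP => // _; lia.
apply/seteqP; split=> [_ [[[n _ <-]|[n _ <-]]|->]|_ [[n|] _ <-]].
- exists (fin (2 * n)) => //=; rewrite /f.
  by case: ifP => [|_]; [lia|rewrite !addnS addn0].
- exists (fin (2 * n + 1)) => //=; rewrite /f; case: ifP => //; lia.
- by exists infty.
- left; rewrite /= /f; case: ifP => on; [right|left]; exists n./2 => //.
    by congr (fin _, fin _); lia.
  by congr (fin _, fin _); lia.
- by right.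
Qed.

Definition crD : CR alphaN := toCR continuous_relD.
Definition crR : CR alphaN := toCR continuous_relR.
Definition crS : CR alphaN := toCR continuous_relS.

(* Main.v *)
Require Import Defs.
From mathcomp Require Import all_boot all_order.
From mathcomp Require Import zify.
From mathcomp Require Import all_classical topology.

(** A clopen subset of [alphaN] is finite or cofinite among the finite points,
so no continuous relation has a domain whose finite points are exactly the
numbers of one parity. But the meet of [D] and [R] would contain every isolated
pair [(2n, 2n)] and, lying below both, have exactly the even numbers as the
finite points of its domain; likewise for [S] with the odd numbers. And in a
decomposition [D = R' `|` S'] the part [R'] must contain [(n, n)] exactly for
even [n]. *)

Local Open Scope classical_set_scope.

(** Near-covering compactness: on the neighbourhood [[set n]] of [n], the bound [n < N] holds for
    all large [N], so one [N] serves all of [C]. *)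
Lemma compact_nat_bounded (C : set nat) :
  compact C -> exists N, forall n, C n -> (n < N)%N.
Proof.
move=> /compact_near_coveringP cC.
have [N _ CN] : \forall N \near \oo, C `<=` [set n | (n < N)%N].
  apply: (cC nat \oo (fun N n => (n < N)%N)) => n _.
  exists ([set n], [set N | (n < N)%N]) => /=.
    by split; [exact: discrete_set1|exists n.+1].
  by case=> m N /= [->].
by exists N; exact: (CN N (leqnn N)).
Qed.

Lemma alphaN_nbhs_infty (U : set alphaN) : nbhs infty U ->
  exists N, forall n, (N <= n)%N -> U (fin n).
Proof.
move=> [C [/compact_nat_bounded[N CN] _] CU]; exists N => n Nn.
by apply: CU; left; exists n => // /CN; rewrite ltnNge Nn.
Qed.

Lemma clopen_alphaN_parity (b : bool) (U : set alphaN) : clopen U ->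
  ~ (forall n, U (fin n) <-> odd n = b).
Proof.
move=> [oU cU] Ub; have [Uoo|Uoo] := pselect (U infty).
  have [N NU] := alphaN_nbhs_infty _ (open_nbhs_nbhs (conj oU Uoo)).
  (* [N + odd N] is even, so this number beyond [N] has the parity opposite to [b]. *)
  by have /Ub := NU (N + odd N + ~~ b)%N ltac:(lia); lia.
have [N NU] :=
  alphaN_nbhs_infty _ (open_nbhs_nbhs (conj (closed_openC cU) Uoo)).
by apply: (NU (N + odd N + b)%N ltac:(lia)); apply/Ub; lia.
Qed.

Lemma continuous_relation_parity (b : bool) (T : set (alphaN * alphaN)) :
  continuous_relation T -> T `<=` relD ->
  ~ (forall n, T (fin n, fin n) <-> odd n = b).
Proof.
(* The domain of [T] is clopen; as [T] lies in the diagonal, [fin n] is in it exactly when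
   [T (fin n, fin n)]. *)
move=> [_ pT] TD Tb; apply: (clopen_alphaN_parity b (rel_preimage T setT)).
  by apply: pT; exact: clopenT.
move=> n; rewrite -Tb; split=> [[y _ Tny]|Tnn]; last by exists (fin n).
by have [x _ [xn xy]] := TD _ Tny; move: Tny; rewrite -xy xn.
Qed.

(** As [fin n] is isolated, every image and preimage is empty or the clopen set [[set fin n]]. *)
Lemma continuous_relation_fin (n : nat) :
  continuous_relation [set (fin n, fin n)].
Proof.
split=> [x|U _].
  have [->|xn] := pselect (x = fin n).
    suff -> : rel_image [set (fin n, fin n)] (fin n) = [set fin n].
      exact: (clopen_fin n).2.
    by apply/seteqP; split=> y /= => [[->]|->].
  suff -> : rel_image [set (fin n, fin n)] x = set0 by exact: closed0.
  by rewrite -subset0 => y /= [/xn].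
have [Un|Un] := pselect (U (fin n)).
  suff -> : rel_preimage [set (fin n, fin n)] U = [set fin n].
    exact: clopen_fin.
  by apply/seteqP; split=> x /= => [[y _ [->]]|->] //; exists (fin n).
suff -> : rel_preimage [set (fin n, fin n)] U = set0 by exact: clopen0.
by rewrite -subset0 => x /= [y Uy [_ yn]]; rewrite yn in Uy.
Qed.

Lemma no_meet_crD (b : bool) (E : CR alphaN) :
  (forall n, (E : set (alphaN * alphaN)) (fin n, fin n) <-> odd n = b) ->
  ~ has_meet crD E.
Proof.
move=> Eb [T [lbT glbT]].
have TD : (T : set _) `<=` crD by rewrite -CR_leE; apply: lbT; left.
have TE : (T : set _) `<=` E by rewrite -CR_leE; apply: lbT; right.
apply: (continuous_relation_parity b T (CR_continuous T) TD) => n.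
split=> [/TE/Eb//|/Eb Enn].
(* The one-pair relation is a lower bound of [crD] and [E], hence lies below their meet [T]. *)
suff : (toCR (continuous_relation_fin n) <= T)%O by rewrite CR_leE; apply.
apply: glbT => _ [->|->]; rewrite CR_leE => _ /= -> //.
by exists (fin n).
Qed.

(** On odd numbers [relR] shifts by 2 and so misses the diagonal. *)
Lemma relR_diag (n : nat) : relR (fin n, fin n) <-> odd n = false.
Proof.
split=> [[[[m _ [<-]]|[m _ [<- /eqP]]]|//]|en]; [lia|lia|].
by left; left; exists n./2 => //; congr (fin _, fin _); lia.
Qed.

Lemma relS_diag (n : nat) : relS (fin n, fin n) <-> odd n = true.
Proof.
split=> [[[[m _ [<- /eqP]]|[m _ [<-]]]|//]|on]; [lia|lia|].
by left; right; exists n./2 => //; congr (fin _, fin _); lia.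
Qed.

Lemma relD_not_split (R' S' : set (alphaN * alphaN)) : continuous_relation R' ->
  R' `<=` relR -> S' `<=` relS -> R' `|` S' <> relD.
Proof.
move=> cR R'R S'S RSD.
apply: (continuous_relation_parity false R' cR) => [|n].
  by rewrite -RSD; exact: subsetUl.
split=> [/R'R/relR_diag//|en].
have : relD (fin n, fin n) by exists (fin n).
by rewrite -RSD => -[//|/S'S/relS_diag]; rewrite en.
Qed.

Theorem theorem2p6 :
  [/\ ~ has_meet crD crR,
      ~ has_meet crD crS,
      ~ (exists R' S' : set (alphaN * alphaN),
          [/\ continuous_relation R', continuous_relation S',
              R' `<=` relR, S' `<=` relS & R' `|` S' = relD]),
      ~ distributive_joinSemilattice (CR alphaN) &
      ~ is_lattice (CR alphaN)].
Proof.
have noDR : ~ has_meet crD crR by apply: (no_meet_crD false); exact: relR_diag.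
split=> //.
- by apply: (no_meet_crD true); exact: relS_diag.
- by move=> [R' [S' [cR _ R'R S'S]]]; exact: relD_not_split.
- move=> /(_ crD crR crS)[|R' [S' []]].
    (* [relD] lies in the union: [relS] covers the odd diagonal pairs, [relR] the even ones and
       infinity. *)
    rewrite CR_leE => _ [[n|] _ <-]; last by left; right.
    by case/boolP: (odd n) => [/relS_diag|/negbTE/relR_diag]; [right|left].
  rewrite !CR_leE => R'R S'S DE.
  by apply: (relD_not_split _ _ (CR_continuous R') R'R S'S); rewrite -CR_joinE -DE.
- by move=> /(_ crD crR)[].
Qed.
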